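(* Consider the heterogeneous bump regression (HBR) model with $|I_n|\searrow 0$ and the testing problem $H_0$ against $H_1^n$. Let $\varepsilon_n>0$ be any sequence such that $\varepsilon_n\sqrt{-\log(|I_n|)}\to\infty$ as $n\to\infty$, and let $\alpha\in(0,1)$ be a given significance level. Furthermore let $\sigma_0\Delta_n=\sigma_n^2\theta_n$ with sequences $\Delta_n,\sigma_n,\theta_n\to0$ as $n\to\infty$, where $\sigma_n^2=o(\varepsilon_n)$, $\theta_n=o(\varepsilon_n)$ and $$\sqrt{n|I_n|}\,\Delta_n\succsim(2\sigma_0+\varepsilon_n)\sqrt{-\log(|I_n|)}\;\theta_n.$$ Then the likelihood ratio test $\Phi_n$, which rejects $H_0$ if and only if $T_n(Y)>c^*_{\alpha,n}$, satisfies $$\limsup_{n\to\infty}\bar\alpha(\Phi_n)\le\alpha\qquad\text{and}\qquad\limsup_{n\to\infty}\bar\beta(\Phi_n)\le\alpha.$$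
   Context: HBR model: for each $n$ one observes $Y=(Y_1,\dots,Y_n)$ with $Y_i=\mu_n(i/n)+\lambda_n(i/n)Z_i$, where $Z_1,\dots,Z_n$ are i.i.d. $\mathcal N(0,1)$. The parameters $\sigma_0>0$ (fixed), $\Delta_n>0$, $\sigma_n>0$ and $|I_n|\in(0,1]$ are known; put $\kappa_n=\sigma_n/\sigma_0$. It is assumed that $l_n:=1/|I_n|\in\mathbb N$ and $n|I_n|\in\mathbb N$, and $\mathcal A_n:=\{((j-1)|I_n|,\,j|I_n|] : 1\le j\le l_n\}$, so that each interval in $\mathcal A_n$ contains exactly $n|I_n|$ of the points $i/n$. The null hypothesis is $H_0:\ \mu_n\equiv 0,\ \lambda_n\equiv\sigma_0$; the alternative is $H_1^n:$ there is $I_n\in\mathcal A_n$ with $\mu_n=\Delta_n 1_{I_n}$ and $\lambda_n^2=\sigma_0^2+\sigma_n^2 1_{I_n}$ (the position of $I_n$ is unknown). For a test $\Phi_n:\mathbb R^n\to\{0,1\}$ (1 means reject $H_0$), the type I error is $\bar\alpha(\Phi_n)=\mathbb P_{H_0}(\Phi_n(Y)=1)$ and the type II error is $\bar\beta(\Phi_n)=\sup_{I_n\in\mathcal A_n}\mathbb P_{\mu_n=\Delta_n1_{I_n},\,\lambda_n^2=\sigma_0^2+\sigma_n^21_{I_n}}(\Phi_n(Y)=0)$. Test statistic: $$T_n(Y):=\sup_{I\in\mathcal A_n}\frac1{\sigma_0^2}\sum_{i:\,i/n\in I}\left(Y_i+\frac{\Delta_n}{\kappa_n^2}\right)^2.$$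 Threshold: $$c^*_{\alpha,n}=n|I_n|+\frac{n|I_n|\Delta_n^2}{\sigma_0^2\kappa_n^4}-2\log(\alpha|I_n|)+2\sqrt{n|I_n|\left(1+2\frac{\Delta_n^2}{\sigma_0^2\kappa_n^4}\right)\log\left(\frac1{\alpha|I_n|}\right)}.$$ Notation: $a_n\succsim b_n$ means there is $N\in\mathbb N$ such that $a_n\ge b_n$ for all $n\ge N$. *)

(* Defs.v *)
From HB Require Import structures.
From mathcomp Require Import all_boot all_order all_algebra.
From mathcomp Require Import all_classical all_reals all_analysis.
Import Order.TTheory GRing.Theory Num.Theory.
Import numFieldNormedType.Exports.

Set Implicit Arguments.
Unset Strict Implicit.
Unset Printing Implicit Defensive.

Local Open Scope classical_set_scope.
Local Open Scope ring_scope.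

Section Independence.
Context {R : realType} {d : measure_display} {T : measurableType d}.
Variable P : probability T R.

Definition mutually_independent (I : finType) (X : I -> {RV P >-> R}) : Prop :=
  forall (J : {set I}) (B : I -> set R),
    (forall i, measurable (B i)) ->
    P (\bigcap_(i in [set` J]) (X i @^-1` B i)) =
      (\prod_(i in J) P (X i @^-1` B i))%E.

(* The law is only compared on Borel sets: [distribution] and [normal_prob]
   are total functions, with irrelevant values outside the sigma-algebra. *)
Definition iid_std_normal (I : finType) (X : I -> {RV P >-> R}) : Prop :=
  mutually_independent X /\
  forall i (B : set R), measurable B ->
    distribution P (X i) B = normal_prob 0 1 B.

End Independence.

Section HeterogeneousBumpRegression.
Context {R : realType}.

(* The observations Y_1, ..., Y_n are indexed by 0 <= i < n, so that the
   (i+1)-st design point is (i+1)/n. *)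
Definition design_point (n : nat) (i : 'I_n) : R := i.+1%:R / n%:R.

Definition HBR {T : Type} (n : nat) (mu lambda : R -> R)
    (Z : 'I_n -> T -> R) (w : T) : 'rV[R]_n :=
  \row_i (mu (design_point i) + lambda (design_point i) * Z i w).

(* [len] is the known length |I_n| of the bump. *)
Definition candidate_intervals (len : R) : set (set R) :=
  [set `](j%:R - 1) * len, j%:R * len]%classic
  | j in [set j : nat | (1 <= j)%N /\ j%:R <= len^-1]].

Definition bump_mean (Delta : R) (I : set R) (x : R) : R := Delta * \1_I x.

Definition bump_sd (sigma0 sigma : R) (I : set R) (x : R) : R :=
  Num.sqrt (sigma0 ^+ 2 + sigma ^+ 2 * \1_I x).

Section Errors.
Context {d : measure_display} {T : measurableType d}.
Variables (P : probability T R) (n : nat) (Z : 'I_n -> {RV P >-> R}).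

Definition type1_error (sigma0 : R) (Phi : 'rV[R]_n -> bool) : \bar R :=
  P [set w | Phi (HBR (cst 0) (cst sigma0) Z w)].

Definition type2_error (sigma0 Delta sigma len : R)
    (Phi : 'rV[R]_n -> bool) : \bar R :=
  ereal_sup
    [set P [set w | ~~ Phi (HBR (bump_mean Delta I) (bump_sd sigma0 sigma I) Z w)]
    | I in candidate_intervals len].

End Errors.

Definition kappa (sigma0 sigma : R) : R := sigma / sigma0.

Definition test_statistic (n : nat) (sigma0 Delta sigma len : R)
    (y : 'rV[R]_n) : R :=
  sup [set (sigma0 ^+ 2)^-1 *
           \sum_(i < n | design_point i \in I)
             (y ord0 i + Delta / kappa sigma0 sigma ^+ 2) ^+ 2
      | I in candidate_intervals len].

Definition threshold (n : nat) (alpha sigma0 Delta sigma len : R) : R :=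
  let m := n%:R * len in
  m + m * Delta ^+ 2 / (sigma0 ^+ 2 * kappa sigma0 sigma ^+ 4)
  - 2 * ln (alpha * len)
  + 2 * Num.sqrt
          (m * (1 + 2 * (Delta ^+ 2 / (sigma0 ^+ 2 * kappa sigma0 sigma ^+ 4)))
           * ln (1 / (alpha * len))).

Definition lr_test (n : nat) (alpha sigma0 Delta sigma len : R)
    (y : 'rV[R]_n) : bool :=
  threshold n alpha sigma0 Delta sigma len <
    test_statistic sigma0 Delta sigma len y.

End HeterogeneousBumpRegression.

(* Main.v *)
Require Import Defs.
From HB Require Import structures.
From mathcomp Require Import all_boot all_order all_algebra.
From mathcomp Require Import all_classical all_reals all_analysis.
From mathcomp Require Import measurable_realfun.
From mathcomp Require Import ring lra.
Import Order.TTheory GRing.Theory Num.Theory.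
Import numFieldNormedType.Exports.

(** The relation [sigma0 * Delta = sigma ^+ 2 * theta] makes the shift
    [Delta / kappa ^+ 2] of the likelihood ratio statistic equal to
    [sigma0 * theta].  Hence, writing [m] for the number of design points in a
    candidate interval and [s = 1 + kappa ^+ 2], the local statistic of an
    interval is a noncentral chi-square variable with [m] degrees of freedom
    and noncentrality [m * theta ^+ 2] under the null hypothesis, and [s] times
    one with noncentrality [m * theta ^+ 2 * s] when the bump sits on that
    interval ([local_statistic_null], [local_statistic_bump]).

    Both errors are then controlled by exponential tail bounds for noncentral
    chi-square variables ([noncentral_chisq_upper_tail],
    [noncentral_chisq_lower_tail]).  The threshold is the upper bound at
    probability [alpha * len]; a union bound over the [1 / len] candidates gives
    a type I error of at most [alpha] for every sample size.  For the type II
    error only the interval carrying the bump matters: its statistic falls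
    below the lower bound at probability [alpha], so it is enough that the
    threshold eventually lies below that bound.  This is where the signal
    strength enters ([threshold_le_bump_quantile]): with
    [r = sqrt (- ln len)], the increase [m * kappa ^+ 2] of the mean exceeds the
    deviation [2 * sqrt m * r] by a multiple of [eps * sqrt m * r], and this
    surplus absorbs all remaining terms, because [theta] and [sigma ^+ 2] are
    negligible with respect to [eps] and [eps * r] tends to infinity.

    The tail bounds follow from Chernoff's inequality.  It rests on the explicit
    value of the exponential moment of a shifted squared normal variable
    ([mgf_shifted_sqr_normal], by completing the square) and on the fact that
    expectations of products of functions of independent variables factor
    ([ge0_integral_prod_indep]).  The latter extends the product rule for events
    to functions one variable at a time: once the other factors are frozen into
    a weight, both sides are integrals of a single function against measures
    that agree on sets ([eq_integral_weighted_pushforward]). *)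

Set Implicit Arguments.
Unset Strict Implicit.
Unset Printing Implicit Defensive.

Local Open Scope classical_set_scope.
Local Open Scope ring_scope.

(** * Weighted images of measures and products of independent variables *)

Section weighted.
Import HBNNSimple.

(** The right-hand side sees [mu], [phi] and [g] only through the weights
    [\int[mu]_(x in phi @^-1` B) g] of measurable sets [B], so two triples with
    the same weights integrate every nonnegative function alike.  It comes from
    approximating [f] from below by simple functions. *)
Lemma ge0_integral_weighted_pushforward (R : realType)
    (d d' : measure_display) (T : measurableType d) (S : measurableType d')
    (mu : {measure set T -> \bar R}) (phi : T -> S) (g : T -> R)
    (f : S -> \bar R) (mf : measurable_fun [set: S] f) :
  measurable_fun setT phi -> measurable_fun setT g ->
  (forall x, 0 <= g x) -> (forall y, (0 <= f y)%E) ->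
  let f_ := nnsfun_approx measurableT mf in
  (\int[mu]_x (f (phi x) * (g x)%:E) =
   limn (fun n => \sum_(r \in range (f_ n))
     r%:E * \int[mu]_(x in phi @^-1` (f_ n @^-1` [set r])) (g x)%:E))%E.
Proof.
move=> mphi mg g0 f0 f_.
have mfn n : measurable_fun setT (f_ n) by exact: measurable_funP.
transitivity (limn (fun n => \int[mu]_x ((f_ n (phi x))%:E * (g x)%:E)))%E.
  rewrite -monotone_convergence//.
  - apply: eq_integral => x _; apply/esym/cvg_lim => //.
    apply: cvgeZr => //.
    by apply: cvg_nnsfun_approx => // *; exact: f0.
  - move=> n; apply: emeasurable_funM; last exact/measurable_EFinP.
    by apply/measurable_EFinP; exact: measurableT_comp.
  - by move=> n x _; rewrite -EFinM lee_fin mulr_ge0.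
  - move=> x _ m n mn; rewrite -!EFinM lee_fin ler_wpM2r//.
    exact/lefP/nd_nnsfun_approx.
congr (limn _); apply/funext => n.
have mpre r : measurable (phi @^-1` (f_ n @^-1` [set r])).
  rewrite -[X in measurable X]setTI; apply: mphi => //.
transitivity (\sum_(r \in range (f_ n)) \int[mu]_x
    (r%:E * ((\1_(phi @^-1` (f_ n @^-1` [set r])) x)%:E * (g x)%:E)))%E.
  rewrite -ge0_integral_fsum//; last 2 first.
  - move=> r; apply: measurable_funeM; apply: emeasurable_funM.
      exact/measurable_EFinP/measurable_indic.
    exact/measurable_EFinP.
  - move=> r x _.
    have [r0|r0] := leP 0 r.
      by rewrite -!EFinM lee_fin !mulr_ge0.
    rewrite indicE memNset ?mul0e ?mule0//= => fr.
    by move: r0; rewrite -fr ltNge fun_ge0.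
  apply: eq_integral => x _.
  rewrite fimfunE -fsumEFin// ge0_mule_fsuml//.
    by apply: eq_fsbigr => r _; rewrite EFinM muleA.
  by move=> r; rewrite EFinM; exact: nnfun_muleindic_ge0.
apply: eq_fsbigr => r; rewrite inE => -[y _ yr].
have r0 : 0 <= r by rewrite -yr.
rewrite ge0_integralZl//.
- congr *%E; rewrite [RHS]integral_mkcond; apply: eq_integral => x _.
  rewrite patchE indicE; case: ifPn => _; by rewrite ?mul1e ?mul0e.
- apply: emeasurable_funM; first exact/measurable_EFinP/measurable_indic.
  exact/measurable_EFinP.
- by move=> x _; rewrite -EFinM lee_fin mulr_ge0.
Qed.

(** This plays the part of a uniqueness theorem for measures with densities:
    it serves both to factor expectations and to integrate against the normal
    density. *)
Lemma eq_integral_weighted_pushforward (R : realType)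
    (d1 d2 d' : measure_display) (T1 : measurableType d1)
    (T2 : measurableType d2) (S : measurableType d')
    (mu1 : {measure set T1 -> \bar R}) (mu2 : {measure set T2 -> \bar R})
    (phi1 : T1 -> S) (phi2 : T2 -> S) (g1 : T1 -> R) (g2 : T2 -> R)
    (f : S -> \bar R) :
  measurable_fun setT phi1 -> measurable_fun setT phi2 ->
  measurable_fun setT g1 -> measurable_fun setT g2 ->
  (forall x, 0 <= g1 x) -> (forall x, 0 <= g2 x) ->
  (forall B, measurable B ->
    \int[mu1]_(x in phi1 @^-1` B) (g1 x)%:E =
    \int[mu2]_(x in phi2 @^-1` B) (g2 x)%:E)%E ->
  measurable_fun setT f -> (forall y, (0 <= f y)%E) ->
  (\int[mu1]_x (f (phi1 x) * (g1 x)%:E) =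
   \int[mu2]_x (f (phi2 x) * (g2 x)%:E))%E.
Proof.
move=> mphi1 mphi2 mg1 mg2 g10 g20 g12 mf f0.
rewrite (ge0_integral_weighted_pushforward _ mf)//.
rewrite (ge0_integral_weighted_pushforward _ mf)//.
congr (limn _); apply/funext => n; apply: eq_fsbigr => r _.
rewrite g12//; exact: measurable_funPTI.
Qed.

End weighted.

Section independence.
Context {R : realType} {d : measure_display} {T : measurableType d}.
Variable P : probability T R.
Variables (I : finType) (X : I -> {RV P >-> R}).
Hypothesis indepX : mutually_independent X.

(** Induction on the list of indices whose factor is an arbitrary function,
    the other factors being indicators.  With indicators only, this is the
    product rule for events.  Releasing the index [a] amounts to comparing the
    weight [G] of the other factors with the constant [c], its expectation: for
    indicators of [X a] they agree by induction. *)
Lemma ge0_integral_prod_indep (J : {set I}) (h : I -> R -> R) :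
  (forall i, measurable_fun setT (h i)) ->
  (forall i x, 0 <= h i x) ->
  (forall i, \int[P]_w (h i (X i w))%:E < +oo)%E ->
  (\int[P]_w (\prod_(i in J) h i (X i w))%:E =
   \prod_(i in J) \int[P]_w (h i (X i w))%:E)%E.
Proof.
move=> mh h0 hoo.
have : forall i, i \notin enum I ->
    exists2 B : set R, measurable B & h i = \1_B.
  by move=> i; rewrite mem_enum.
elim: (enum I) h mh h0 hoo => [|a s IH] h mh h0 hoo hind.
  (* No index is left: the integrand is the indicator of an intersection. *)
  have {}hind i : {B : set R | measurable B & h i = \1_B}.
    by apply: cid2; exact: hind.
  pose B i := s2val (hind i).
  have mB i : measurable (B i) by rewrite /B; case: (hind i).
  have hB i : h i = \1_(B i) by rewrite /B; case: (hind i).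
  have mXB i : measurable (X i @^-1` B i).
    by rewrite -[X in measurable X]setTI; exact: measurable_funP.
  under [RHS]eq_bigr => i _.
    under eq_integral => w _ do rewrite hB -[\1_ _ (X i w)]/((\1_(X i @^-1` B i)) w).
    rewrite integral_indic// setIT; over.
  rewrite -indepX//.
  transitivity (\int[P]_w (\1_(\bigcap_(i in [set` J]) (X i @^-1` B i)) w)%:E)%E.
    apply: eq_integral => w _; congr EFin.
    rewrite indicE; case: (boolP (w \in _)) => [|].
      rewrite inE => wB; rewrite big1// => i iJ; rewrite hB indicE mem_set//.
      exact: wB.
    move=> /negP wB; apply/eqP; rewrite prodf_seq_eq0.
    apply/hasP; apply: contrapT => nh; apply: wB; rewrite inE => i iJ.
    apply: contrapT => nwB; apply: nh; exists i; rewrite ?mem_index_enum//.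
    by rewrite iJ/= hB indicE memNset.
  rewrite integral_indic//= ?setIT//.
  apply: fin_bigcap_measurable => //; exact: finite_finset.
(* The family [h] with the factor of index [a] replaced by [b]. *)
pose upd (b : R -> R) i := if i == a then b else h i.
have updP (b : R -> R) : measurable_fun setT b -> (forall x, 0 <= b x) ->
    (\int[P]_w (b (X a w))%:E < +oo)%E ->
    (exists2 B : set R, measurable B & b = \1_B) ->
    (\int[P]_w (\prod_(i in J) upd b i (X i w))%:E =
     \prod_(i in J) \int[P]_w (upd b i (X i w))%:E)%E.
  move=> mb b0 boo bB; apply: IH.
  - by move=> i; rewrite /upd; case: ifP.
  - by move=> i x; rewrite /upd; case: ifP.
  - by move=> i; rewrite /upd; case: (i =P a) => [->|].
  - move=> i si; rewrite /upd; case: (i =P a) => [//|/eqP ia].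
    by apply: hind; rewrite inE negb_or ia.
have indP (B : set R) : measurable B ->
    (\int[P]_w (\prod_(i in J) upd \1_B i (X i w))%:E =
     \prod_(i in J) \int[P]_w (upd \1_B i (X i w))%:E)%E.
  move=> mB; apply: updP => //.
  - have mXB : measurable (X a @^-1` B).
      by rewrite -[X in measurable X]setTI; exact: measurable_funP.
    under eq_integral => w _ do rewrite -[\1_ _ (X a w)]/((\1_(X a @^-1` B)) w).
    rewrite integral_indic// setIT; exact: le_lt_trans (probability_le1 _ _) (ltry _).
  - by exists B.
have [aJ|aJ] := boolP (a \in J); last first.
  have updJ i : i \in J -> upd \1_setT i = h i.
    by move=> iJ; rewrite /upd; case: (i =P a) => // ia; rewrite -ia iJ in aJ.
  transitivity (\int[P]_w (\prod_(i in J) upd \1_setT i (X i w))%:E)%E.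
    by apply: eq_integral => w _; congr EFin; apply: eq_bigr => i /updJ ->.
  by rewrite indP//; apply: eq_bigr => i /updJ ->.
pose c := (\prod_(i in J | i != a) \int[P]_w (h i (X i w))%:E)%E.
have c0 : (0 <= c)%E.
  by apply: prode_ge0 => i _; apply: integral_ge0 => w _; rewrite lee_fin.
have cfin : c \is a fin_num.
  apply: prode_fin_num => i _; rewrite ge0_fin_numE//.
  by apply: integral_ge0 => w _; rewrite lee_fin.
pose G w := \prod_(i in J | i != a) h i (X i w).
have mhX i : measurable_fun setT (fun w => h i (X i w)).
  by apply: measurableT_comp.
have updN b i : i != a -> upd b i = h i by rewrite /upd => /negbTE ->.
have upda b : upd b a = b by rewrite /upd eqxx.
transitivity (\int[P]_w ((h a (X a w))%:E * (G w)%:E))%E.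
  by apply: eq_integral => w _; rewrite (bigD1 a)//= EFinM.
rewrite (@eq_integral_weighted_pushforward _ _ _ _ _ _ _ P P (X a) (X a) G
   (cst (fine c)) (EFin \o h a))//.
- rewrite /= ge0_integralZr//.
  + by rewrite fineK// [RHS](bigD1 a).
  + exact/measurable_EFinP.
  + by move=> w _; rewrite lee_fin.
  + by rewrite fineK.
- rewrite /G; under eq_fun do rewrite -big_filter.
  by apply: measurable_prod => i _.
- by move=> w; apply: prodr_ge0.
- by move=> x; rewrite fine_ge0.
- move=> B mB.
  have mXB : measurable (X a @^-1` B).
    by rewrite -[X in measurable X]setTI; exact: measurable_funP.
  rewrite [RHS](integral_cst P mXB (fine c)%:E) fineK//.
  have := indP _ mB; rewrite [RHS](bigD1 a)//= upda.
  under [X in (_ = _ * X)%E -> _]eq_bigr => i /andP[_ ia] do rewrite updN//.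
  under [X in (_ = X * _)%E -> _]eq_integral => w _
    do rewrite -[\1_ _ (X a w)]/((\1_(X a @^-1` B)) w).
  rewrite integral_indic// setIT -/c muleC => <-.
  rewrite integral_mkcond; apply: eq_integral => w _.
  rewrite (bigD1 a)//= upda patchE indicE.
  under [in RHS]eq_bigr => i /andP[_ ia] do rewrite updN//.
  have -> : (X a w \in B) = (w \in X a @^-1` B).
    by apply/idP/idP; rewrite !inE.
  by case: ifP; rewrite ?mul1r ?mul0r.
- exact/measurable_EFinP.
- by move=> y; rewrite lee_fin.
Qed.

End independence.

(** * Exponential moments of shifted squared normal variables *)

Section elementary.
Context {R : realType}.
Implicit Types (x y u w t b : R).

(** [y <= sinh y]; the derivative [expR x + expR (- x) - 2] of the difference
    is nonnegative because [1 + x <= expR x]. *)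
Lemma mul2_le_expRB y : 0 <= y -> 2 * y <= expR y - expR (- y).
Proof.
pose f y : R := expR y - expR (- y) - 2 * y.
have df x : is_derive x 1 f (expR x + expR (- x) - 2).
  by rewrite /f; apply: is_derive_eq; rewrite /GRing.scale /=; ring.
move=> y0; rewrite -subr_ge0 -[leLHS]/0.
have -> : 0 = f 0 by rewrite /f oppr0 subrr mulr0 subrr.
apply: (@ger0_derive1_ndecry R f 0) => // [x _|].
- rewrite derive1E; have [_ ->] := df x.
  have := expR_ge1Dx x; have := expR_ge1Dx (- x); lra.
- apply: continuous_subspaceT => x; apply: differentiable_continuous.
  by apply/derivable1_diffP; case: (df x).
Qed.

(** Unlike [ln w <= w - 1], this bound is exact to second order at [w = 1], as
    needed for the variance term of the upper tail to have the right
    constant. *)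
Lemma ln_le_half_subV w : 1 <= w -> ln w <= (w - w^-1) / 2.
Proof.
move=> w1; have w0 : 0 < w by exact: lt_le_trans w1.
have := mul2_le_expRB (ln_ge0 w1).
rewrite expRN lnK ?posrE//; lra.
Qed.

Lemma ln1D_ge_sub_sqr u : 0 <= u -> u - u ^+ 2 / 2 <= ln (1 + u).
Proof.
pose f u : R := ln (1 + u) - u + u ^+ 2 / 2.
have df x : 0 <= x -> is_derive x 1 f ((1 + x)^-1 - 1 + x).
  move=> x0; have x10 : 0 < 1 + x by rewrite ltr_wpDr.
  have ? := is_derive1_ln x10.
  by rewrite /f; apply: is_derive_eq; rewrite /GRing.scale /=; field; rewrite gt_eqF.
move=> u0; rewrite -subr_ge0.
have -> : ln (1 + u) - (u - u ^+ 2 / 2) = f u by rewrite /f; ring.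
have -> : 0 = f 0 by rewrite /f addr0 ln1; ring.
apply: (@ger0_derive1_ndecry R f 0) => // [x||].
- by rewrite in_itv/= andbT => /ltW/df dfx; case: dfx.
- move=> x; rewrite in_itv/= andbT => x0; rewrite derive1E.
  have [_ ->] := df x (ltW x0).
  have -> : (1 + x)^-1 - 1 + x = x ^+ 2 / (1 + x).
    by field; rewrite gt_eqF// ltr_wpDr// ltW.
  by rewrite divr_ge0 ?sqr_ge0// addr_ge0// ltW.
- apply: derivable_within_continuous => x.
  by rewrite in_itv/= andbT => /df dfx; case: dfx.
Qed.

End elementary.

Section gauss.
Context {R : realType}.
Implicit Types (x t b : R).

(** The law of [Y] is known on Borel sets only, which is exactly what comparing
    weights requires. *)
Lemma integral_std_normal (d : measure_display) (T : measurableType d)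
    (P : probability T R) (Y : {RV P >-> R}) (f : R -> R) :
  (forall B, measurable B -> distribution P Y B = normal_prob 0 1 B) ->
  measurable_fun setT f -> (forall x, 0 <= f x) ->
  (\int[P]_w (f (Y w))%:E =
   \int[lebesgue_measure]_x ((f x)%:E * (normal_pdf 0 1 x)%:E))%E.
Proof.
move=> lawY mf f0.
rewrite -(@eq_integral_weighted_pushforward R _ _ _ _ _ _
  P lebesgue_measure Y id (cst 1) (normal_pdf 0 1) (EFin \o f))//.
- by apply: eq_integral => w _; rewrite mule1.
- exact: measurable_normal_pdf.
- by move=> x; exact: normal_pdf_ge0.
- move=> B mB; have mYB : measurable (Y @^-1` B) by exact: measurable_funPTI.
  rewrite preimage_id [LHS](integral_cst _ mYB 1%:E) mul1e.
  exact: lawY.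
- exact/measurable_EFinP.
Qed.

(** Completing the square turns the integrand into a constant multiple of the
    density of the normal law of mean [2 * t * b / v] and variance [1 / v], for
    [v = 1 - 2 * t]. *)
Lemma mgf_shifted_sqr_normal t b : t < 1 / 2 ->
  (\int[lebesgue_measure]_x
     ((expR (t * (x + b) ^+ 2))%:E * (normal_pdf 0 1 x)%:E) =
   (expR (t * b ^+ 2 / (1 - 2 * t) - ln (1 - 2 * t) / 2))%:E)%E.
Proof.
move=> t2; have v0 : 0 < 1 - 2 * t by lra.
set v := 1 - 2 * t in v0 *.
have vE : v = expR (ln v / 2) ^+ 2.
  by rewrite -expRM_natr mulrVK ?unitfE// lnK.
pose s := (expR (ln v / 2))^-1.
have s0 : 0 < s by rewrite invr_gt0 expR_gt0.
have sE : s ^+ 2 = v^-1 by rewrite /s exprVn -vE.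
pose m := 2 * t * b / v.
transitivity (\int[lebesgue_measure]_x
   ((expR (t * b ^+ 2 / v - ln v / 2))%:E * (normal_pdf m s x)%:E))%E.
  apply: eq_integral => x _; rewrite -!EFinM; congr EFin.
  rewrite !normal_pdfE ?oner_eq0 ?gt_eqF//.
  have -> : normal_peak 1 = expR (- (ln v / 2)) * normal_peak s :> R.
    rewrite /normal_peak expRN -/s sE.
    have -> : v^-1 * pi *+ 2 = s ^+ 2 * (1 ^+ 2 * pi *+ 2) :> R.
      by rewrite sE; ring.
    by rewrite sqrtrM ?sqr_ge0// sqrtr_sqr gtr0_norm// invfM mulVKf// gt_eqF.
  rewrite /normal_fun [RHS]mulrCA -expRD.
  transitivity (normal_peak s * expR (t * (x + b) ^+ 2 - ln v / 2 +
      - (x - 0) ^+ 2 / (1 ^+ 2 *+ 2))); first by rewrite !expRD; ring.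
  congr (_ * expR _); rewrite sE /m /v; field.
  by rewrite -/v gt_eqF.
rewrite ge0_integralZl//.
- by rewrite integral_normal_pdf mule1.
- by apply/measurable_EFinP; exact: measurable_normal_pdf.
- by move=> x _; rewrite lee_fin normal_pdf_ge0.
Qed.

End gauss.

(** * Tail bounds for noncentral chi-square variables *)

Section tails.
Context {R : realType} {d : measure_display} {T : measurableType d}.
Variable P : probability T R.
Variables (I : finType) (X : I -> {RV P >-> R}).

Lemma chernoff_indep (J : {set I}) (g : I -> R -> R) (a : R) :
  mutually_independent X ->
  (forall i, measurable_fun setT (g i)) ->
  (forall i, \int[P]_w (expR (g i (X i w)))%:E < +oo)%E ->
  (P [set w | a <= \sum_(i in J) g i (X i w)]%R <=
   \prod_(i in J) \int[P]_w (expR (g i (X i w)))%:E * (expR (- a))%:E)%E.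
Proof.
move=> indepX mg goo.
have mS : measurable_fun setT (fun w => \sum_(i in J) g i (X i w)).
  under eq_fun do rewrite -big_filter.
  by apply: measurable_sum => i; exact: measurableT_comp.
pose S : {RV P >-> R} := mfun_Sub (mem_set mS).
have := chernoff S a ltr01; rewrite mul1r /mmt_gen_fun unlock.
congr (_ <= _ * _)%E.
under eq_integral => w _ do rewrite /= mulr1 expR_sum.
apply: (ge0_integral_prod_indep indepX J (h := fun i y => expR (g i y))) => //.
by move=> i; exact: measurableT_comp.
Qed.

Lemma measurable_sum_shifted_sqr (J : {set I}) (b : I -> R) :
  measurable_fun setT (fun w => \sum_(i in J) (X i w + b i) ^+ 2).
Proof.
under eq_fun do rewrite -big_filter.
apply: measurable_sum => i; apply: measurable_funX.
exact: measurable_funD.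
Qed.

Hypothesis iidX : iid_std_normal X.

Lemma mgf_shifted_sqr_iid t b i : t < 1 / 2 ->
  (\int[P]_w (expR (t * (X i w + b) ^+ 2))%:E =
   (expR (t * b ^+ 2 / (1 - 2 * t) - ln (1 - 2 * t) / 2))%:E)%E.
Proof.
move=> t2; rewrite -mgf_shifted_sqr_normal//.
apply: (integral_std_normal (f := fun y => expR (t * (y + b) ^+ 2))).
- exact: iidX.2.
- apply: measurableT_comp => //; apply: measurable_funM => //.
  by apply: measurable_funX; exact: measurable_funD.
- by move=> y; exact: expR_ge0.
Qed.

(** Since [t] may be negative, this covers both tails. *)
Lemma chernoff_shifted_sqr t (a : R) (J : {set I}) (b : I -> R) : t < 1 / 2 ->
  (P [set w | a <= t * \sum_(i in J) (X i w + b i) ^+ 2]%R <=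
   (expR (\sum_(i in J) (t * b i ^+ 2 / (1 - 2 * t) - ln (1 - 2 * t) / 2)
      - a))%:E)%E.
Proof.
move=> t2.
under eq_set do rewrite mulr_sumr.
rewrite expRD expR_sum EFinM -prodEFin.
under [X in (_ <= X * _)%E]eq_bigr => i _ do rewrite -(mgf_shifted_sqr_iid _ i t2).
apply: (@chernoff_indep J (fun i y => t * (y + b i) ^+ 2)).
- exact: iidX.1.
- move=> i; apply: measurable_funM => //; apply: measurable_funX.
  exact: measurable_funD.
- by move=> i; rewrite mgf_shifted_sqr_iid// ltry.
Qed.

(** The log-moment generating function of the centred sum at [t] is at most
    [t ^+ 2 * D / (1 - 2 * t)], where [D] is half the variance.  With
    [q = sqrt D] and [r = sqrt x], the choice [t = r / (q + 2 * r)] turns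
    Chernoff's exponent into exactly [- x]. *)
Lemma noncentral_chisq_upper_tail (J : {set I}) (b : I -> R) (x : R) :
  J != finset.set0 -> 0 < x ->
  (P [set w | \sum_(i in J) (1 + b i ^+ 2) +
        2 * Num.sqrt ((\sum_(i in J) (1 + 2 * b i ^+ 2)) * x) + 2 * x <=
      \sum_(i in J) (X i w + b i) ^+ 2]%R <= (expR (- x))%:E)%E.
Proof.
set M := \sum_(i in J) (1 + b i ^+ 2); set D := \sum_(i in J) (1 + 2 * _).
move=> J0 x0.
have D0 : 0 < D.
  have D1 i : 0 < 1 + 2 * b i ^+ 2 by rewrite ltr_wpDr// mulr_ge0 ?sqr_ge0.
  case/finset.set0Pn: J0 => j jJ; rewrite /D (bigD1 j)//=.
  by rewrite ltr_wpDr// sumr_ge0// => i _; exact: ltW.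
pose q := Num.sqrt D; pose r := Num.sqrt x.
have q0 : 0 < q by rewrite sqrtr_gt0.
have r0 : 0 < r by rewrite sqrtr_gt0.
have qE : q ^+ 2 = D by rewrite sqr_sqrtr// ltW.
have rE : r ^+ 2 = x by rewrite sqr_sqrtr// ltW.
have Dx : Num.sqrt (D * x) = q * r by rewrite sqrtrM// ltW.
have z0 : 0 < q + 2 * r by rewrite addr_gt0// mulr_gt0.
pose t := r / (q + 2 * r).
have vE : 1 - 2 * t = q / (q + 2 * r) by rewrite /t; field; rewrite gt_eqF.
have v0 : 0 < 1 - 2 * t by rewrite vE divr_gt0.
have t2 : t < 1 / 2 by lra.
set a := M + _ + _.
have t_gt0 : 0 < t by rewrite divr_gt0.
have -> : [set w | a <= \sum_(i in J) (X i w + b i) ^+ 2] =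
          [set w | t * a <= t * \sum_(i in J) (X i w + b i) ^+ 2].
  by apply: eq_set => w; rewrite ler_pM2l.
apply: le_trans (chernoff_shifted_sqr _ _ _ t2) _.
rewrite lee_fin ler_expR.
have lnv : - ln (1 - 2 * t) / 2 <= t + t ^+ 2 / (1 - 2 * t).
  rewrite -lnV ?posrE//.
  have : 1 <= (1 - 2 * t)^-1 by rewrite invf_ge1//; lra.
  move/ln_le_half_subV; rewrite invrK => /(ler_wpM2r (_ : 0 <= 2^-1)).
  move=> /(_ ltac:(by rewrite invr_ge0)) /le_trans; apply.
  by rewrite le_eqVlt; apply/orP; left; apply/eqP; field; rewrite gt_eqF.
have : \sum_(i in J) (t * b i ^+ 2 / (1 - 2 * t) - ln (1 - 2 * t) / 2) <=
       t * M + t ^+ 2 / (1 - 2 * t) * D.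
  rewrite /M /D !mulr_sumr -big_split/=; apply: ler_sum => i _.
  have <- : t * b i ^+ 2 / (1 - 2 * t) + (t + t ^+ 2 / (1 - 2 * t)) =
      t * (1 + b i ^+ 2) + t ^+ 2 / (1 - 2 * t) * (1 + 2 * b i ^+ 2).
    by field; rewrite gt_eqF.
  by rewrite lerD2l -mulNr.
suff <- : t * M + t ^+ 2 / (1 - 2 * t) * D - t * a = - x by rewrite lerD2r.
rewrite /a Dx -qE -rE vE /t; field.
by rewrite !gt_eqF.
Qed.

(** At [- t], with [0 <= t], the log-moment generating function of the centred
    sum is at most [t ^+ 2 * D], and [t = sqrt (x / D)] is optimal. *)
Lemma noncentral_chisq_lower_tail (J : {set I}) (b : I -> R) (x : R) :
  J != finset.set0 -> 0 < x ->
  (P [set w | \sum_(i in J) (X i w + b i) ^+ 2 <=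
      \sum_(i in J) (1 + b i ^+ 2) -
        2 * Num.sqrt ((\sum_(i in J) (1 + 2 * b i ^+ 2)) * x)]%R <= (expR (- x))%:E)%E.
Proof.
set M := \sum_(i in J) (1 + b i ^+ 2); set D := \sum_(i in J) (1 + 2 * _).
move=> J0 x0.
have D0 : 0 < D.
  have D1 i : 0 < 1 + 2 * b i ^+ 2 by rewrite ltr_wpDr// mulr_ge0 ?sqr_ge0.
  case/finset.set0Pn: J0 => j jJ; rewrite /D (bigD1 j)//=.
  by rewrite ltr_wpDr// sumr_ge0// => i _; exact: ltW.
pose q := Num.sqrt D; pose r := Num.sqrt x.
have q0 : 0 < q by rewrite sqrtr_gt0.
have r0 : 0 < r by rewrite sqrtr_gt0.
have qE : q ^+ 2 = D by rewrite sqr_sqrtr// ltW.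
have rE : r ^+ 2 = x by rewrite sqr_sqrtr// ltW.
have Dx : Num.sqrt (D * x) = q * r by rewrite sqrtrM// ltW.
pose t := r / q.
have t0 : 0 < t by rewrite divr_gt0.
set a := M - _.
have -> : [set w | \sum_(i in J) (X i w + b i) ^+ 2 <= a] =
          [set w | - t * a <= - t * \sum_(i in J) (X i w + b i) ^+ 2].
  by apply: eq_set => w; rewrite ler_nM2l// oppr_lt0.
have t2 : - t < 1 / 2 by lra.
apply: le_trans (chernoff_shifted_sqr _ _ _ t2) _.
rewrite lee_fin ler_expR.
have -> : 1 - 2 * - t = 1 + 2 * t by ring.
have v0 : 0 < 1 + 2 * t by lra.
have lnv : - ln (1 + 2 * t) / 2 <= - t + t ^+ 2.
  by have := @ln1D_ge_sub_sqr R (2 * t) (ltac:(lra)); lra.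
have : \sum_(i in J) (- t * b i ^+ 2 / (1 + 2 * t) - ln (1 + 2 * t) / 2) <=
       - t * M + t ^+ 2 * D.
  rewrite /M /D !mulr_sumr -big_split/=; apply: ler_sum => i _.
  have : 0 <= 4 * t ^+ 3 * b i ^+ 2 / (1 + 2 * t).
    rewrite divr_ge0 ?(ltW v0)//.
    by rewrite mulr_ge0 ?sqr_ge0// mulr_ge0// exprn_ge0// ltW.
  have -> : - t * b i ^+ 2 / (1 + 2 * t) =
     - t * b i ^+ 2 + 2 * t ^+ 2 * b i ^+ 2 - 4 * t ^+ 3 * b i ^+ 2 / (1 + 2 * t).
    by field; rewrite gt_eqF.
  lra.
suff <- : - t * M + t ^+ 2 * D - - t * a = - x by rewrite lerD2r.
rewrite /a Dx -qE -rE /t; field.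
by rewrite !gt_eqF.
Qed.

End tails.

(** * Errors of the likelihood ratio test for a fixed sample size *)

Section bump.
Context {R : realType}.
Variables (n m l : nat) (len : R).
Hypotheses (n_gt0 : (0 < n)%N) (len_gt0 : 0 < len).
Hypotheses (mE : n%:R * len = m%:R) (lE : len^-1 = l%:R).

Definition interval_at (len : R) (j : nat) : set R :=
  `](j%:R - 1) * len, j%:R * len]%classic.

Definition block (n : nat) (I : set R) : {set 'I_n} :=
  [set i | @design_point R n i \in I]%SET.

Lemma in_block (I : set R) (i : 'I_n) :
  (i \in block n I) = (design_point i \in I).
Proof. by rewrite finset.inE. Qed.

(** Indices start at 0, whence the bounds closed on the left although the
    intervals are closed on the right. *)
Lemma design_point_in_interval (i : 'I_n) j :
  (design_point i \in interval_at len j.+1) = (j * m <= i < j.+1 * m)%N.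
Proof.
have n0 : 0 < n%:R :> R by rewrite ltr0n.
have -> : len = m%:R / n%:R by rewrite -mE mulrC mulKf// gt_eqF.
rewrite /interval_at /design_point mem_setE in_itv/=.
have -> : j.+1%:R - 1 = j%:R :> R by rewrite -natr1 addrK.
by rewrite !mulrA ltr_pM2r ?invr_gt0// ler_pM2r ?invr_gt0// -!natrM ltr_nat ler_nat ltnS.
Qed.

Lemma card_block j : (j < l)%N -> #|block n (interval_at len j.+1)| = m.
Proof.
move=> jl.
have nE : n = (l * m)%N.
  apply/eqP; rewrite -(eqr_nat R) natrM -lE -mE mulrCA mulVf ?mulr1//.
  by rewrite gt_eqF.
have jmn : (j.+1 * m <= n)%N by rewrite nE leq_mul2r jl orbT.
rewrite -sum1_card.
under eq_bigl do rewrite in_block design_point_in_interval.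
rewrite -(big_mkord (fun i => j * m <= i < j.+1 * m)%N (fun=> 1%N)).
rewrite (big_cat_nat (n := (j * m)%N))//=; last first.
  by rewrite (leq_trans _ jmn)// leq_mul2r leqnSn orbT.
rewrite (big_cat_nat (m := (j * m)%N) (n := (j.+1 * m)%N))//=; last first.
  by rewrite leq_mul2r leqnSn orbT.
rewrite big_nat_cond big1 ?add0n; last first.
  by move=> i /andP[/andP[_ ij] /andP[ji _]]; rewrite ltnNge ji in ij.
rewrite [X in (_ + X)%N]big_nat_cond [X in (_ + X)%N]big1 ?addn0; last first.
  by move=> i /andP[/andP[ij _] /andP[_ ji]]; rewrite ltnNge ij in ji.
rewrite big_nat_cond (eq_bigl (fun i => j * m <= i < j.+1 * m)%N); last first.
  by move=> i /=; rewrite andbb.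
by rewrite -big_nat sum_nat_const_nat muln1 mulSn addnK.
Qed.

Lemma candidate_intervalsE :
  candidate_intervals len = [set interval_at len j.+1 | j in `I_l].
Proof.
rewrite /candidate_intervals lE; apply/seteqP; split => [_ [j /= [j1 jl] <-]|].
  case: j j1 jl => // j _; rewrite ler_nat => jl; by exists j.
by move=> _ [j /= jl <-]; exists j.+1 => //=; rewrite ler_nat.
Qed.

Definition local_statistic (sigma0 Delta sigma : R) (I : set R)
    (y : 'rV[R]_n) : R :=
  (sigma0 ^+ 2)^-1 * \sum_(i < n | design_point i \in I)
    (y ord0 i + Delta / kappa sigma0 sigma ^+ 2) ^+ 2.

(** A supremum exceeds [c] as soon as one element does only if the set is
    bounded; here the sum over all the observations is a bound. *)
Lemma lt_test_statisticP (sigma0 Delta sigma c : R) (y : 'rV[R]_n) :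
  (0 < l)%N ->
  c < test_statistic sigma0 Delta sigma len y <->
  exists2 j, (j < l)%N &
    c < local_statistic sigma0 Delta sigma (interval_at len j.+1) y.
Proof.
move=> l0; rewrite /test_statistic candidate_intervalsE.
set E := (X in sup X); split.
  move/sup_gt => [|_ [_ [j jl <-] <-] cj]; last by exists j.
  by eexists; exists (interval_at len 1) => //; exists 0%N.
move=> [j jl cj]; apply: (lt_le_trans cj); apply: ub_le_sup.
  exists ((sigma0 ^+ 2)^-1 *
    \sum_(i < n) (y ord0 i + Delta / kappa sigma0 sigma ^+ 2) ^+ 2).
  move=> _ [I _ <-]; rewrite ler_wpM2l ?invr_ge0 ?sqr_ge0//.
  rewrite big_mkcond; apply: ler_sum => i _.
  by case: ifP => // _; exact: sqr_ge0.
by exists (interval_at len j.+1) => //; exists j.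
Qed.

Section errors.
Context {d : measure_display} {T : measurableType d}.
Variables (P : probability T R) (Z : 'I_n -> {RV P >-> R}).
Variables (sigma0 alpha Delta sigma theta : R).
Hypotheses (iidZ : iid_std_normal Z) (sigma0_gt0 : 0 < sigma0).
Hypotheses (alpha01 : 0 < alpha < 1) (len_le1 : len <= 1).
Hypotheses (sigma_gt0 : 0 < sigma).
Hypothesis thetaE : sigma0 * Delta = sigma ^+ 2 * theta.

Let l_gt0 : (0 < l)%N.
Proof. by rewrite -(ltr_nat R) -lE invr_gt0. Qed.

Let m_gt0 : (0 < m)%N.
Proof. by rewrite -(ltr_nat R) -mE mulr_gt0// ltr0n. Qed.

Let block_neq0 j : (j < l)%N -> block n (interval_at len j.+1) != finset.set0.
Proof. by move=> jl; rewrite -card_gt0 card_block. Qed.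

Let shiftE : Delta / kappa sigma0 sigma ^+ 2 = sigma0 * theta.
Proof.
have -> : Delta = sigma ^+ 2 * theta / sigma0.
  by rewrite -thetaE mulrAC divff ?mul1r// gt_eqF.
by rewrite /kappa; field; rewrite !gt_eqF.
Qed.

Lemma thresholdE :
  threshold n alpha sigma0 Delta sigma len =
  m%:R * (1 + theta ^+ 2) +
  2 * Num.sqrt (m%:R * (1 + 2 * theta ^+ 2) * - ln (alpha * len)) +
  2 * - ln (alpha * len).
Proof.
have thetaq : Delta ^+ 2 / (sigma0 ^+ 2 * kappa sigma0 sigma ^+ 4) = theta ^+ 2.
  have -> : theta = Delta / kappa sigma0 sigma ^+ 2 / sigma0.
    by rewrite shiftE mulrAC divff ?mul1r// gt_eqF.
  by rewrite /kappa; field; rewrite !gt_eqF.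
have /andP[alpha0 _] := alpha01.
rewrite /threshold mE -mulrA thetaq div1r lnV ?posrE ?mulr_gt0//.
by ring.
Qed.

Lemma measurable_local_statistic (mu lambda : R -> R) (I : set R) :
  measurable_fun setT
    (fun w => local_statistic sigma0 Delta sigma I (HBR mu lambda Z w)).
Proof.
apply: measurable_funM => //.
under eq_fun do rewrite -big_filter.
apply: measurable_sum => i; apply: measurable_funX; apply: measurable_funD => //.
under eq_fun do rewrite mxE.
by apply: measurable_funD => //; apply: measurable_funM.
Qed.

Lemma local_statistic_null (I : set R) w :
  local_statistic sigma0 Delta sigma I (HBR (cst 0) (cst sigma0) Z w) =
  \sum_(i in block n I) (Z i w + theta) ^+ 2.
Proof.
rewrite /local_statistic mulr_sumr.
apply: eq_big => [i|i _]; first by rewrite in_block.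
by rewrite mxE shiftE/=; field; rewrite gt_eqF.
Qed.

(** On the bump the shifted observation is
    [sigma0 * sqrt s * (Z i + theta * sqrt s)], because
    [Delta = sigma0 * theta * (s - 1)]. *)
Lemma local_statistic_bump (I : set R) w (s := 1 + kappa sigma0 sigma ^+ 2) :
  local_statistic sigma0 Delta sigma I
    (HBR (bump_mean Delta I) (bump_sd sigma0 sigma I) Z w) =
  s * \sum_(i in block n I) (Z i w + theta * Num.sqrt s) ^+ 2.
Proof.
rewrite /local_statistic !mulr_sumr.
have s0 : 0 < s by rewrite ltr_wpDr// sqr_ge0.
apply: eq_big => [i|i iI]; first by rewrite in_block.
rewrite mxE shiftE/= /bump_mean /bump_sd indicE iI !mulr1.
have -> : sigma0 ^+ 2 + sigma ^+ 2 = sigma0 ^+ 2 * s.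
  by rewrite /s /kappa; field; rewrite gt_eqF.
rewrite sqrtrM ?sqr_ge0// sqrtr_sqr gtr0_norm//.
have -> : Delta = sigma0 * theta * (s - 1).
  by rewrite -shiftE /s addrAC subrr add0r divfK// expf_neq0// mulf_neq0 ?invr_eq0 ?gt_eqF.
have := sqr_sqrtr (ltW s0); move: (Num.sqrt s) => r <-.
by field; rewrite gt_eqF.
Qed.

Let lr_test_event (mu lambda : R -> R) :
  [set w | lr_test alpha sigma0 Delta sigma len (HBR mu lambda Z w)] =
  \bigcup_(j in `I_l) [set w | threshold n alpha sigma0 Delta sigma len <
    local_statistic sigma0 Delta sigma (interval_at len j.+1)
      (HBR mu lambda Z w)].
Proof.
apply/seteqP; split => [w /=|w].
  by move=> /(lt_test_statisticP _ _ _ _ _ l_gt0)[j jl cj]; exists j.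
by move=> [j jl cj]; apply/(lt_test_statisticP _ _ _ _ _ l_gt0); exists j.
Qed.

Let measurable_exceedance (mu lambda : R -> R) (c : R) (I : set R) :
  measurable [set w | c <
    local_statistic sigma0 Delta sigma I (HBR mu lambda Z w)].
Proof.
rewrite -[X in measurable X]setTI -preimage_itvoy.
by apply: measurable_local_statistic.
Qed.

(** Each of the [1 / len] local statistics exceeds the threshold with
    probability at most [alpha * len]. *)
Lemma type1_error_lr_test_le :
  (type1_error Z sigma0 (lr_test alpha sigma0 Delta sigma len) <= alpha%:E)%E.
Proof.
have /andP[alpha0 alpha1] := alpha01.
have al0 : 0 < alpha * len by rewrite mulr_gt0.
have L0 : 0 < - ln (alpha * len).
  by rewrite oppr_gt0 ln_lt0// al0/= (le_lt_trans (ler_piMr (ltW alpha0) len_le1)).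
rewrite /type1_error lr_test_event.
apply: le_trans.
  apply: (content_sub_fsum _ (finite_II l) _ _ (@subset_refl _ _)) => //.
  exact: bigcup_measurable.
rewrite -fsbig_ord.
apply: (@le_trans _ _ (\sum_(j < l) (alpha * len)%:E)%E).
  apply: lee_sum => -[j jl] _ /=.
  have := noncentral_chisq_upper_tail iidZ (fun=> theta) (block_neq0 jl) L0.
  rewrite !sumr_const (card_block jl) opprK lnK//.
  apply: le_trans; apply: le_measure; rewrite ?inE.
  - exact: measurable_exceedance.
  - rewrite -[X in measurable X]setTI -preimage_itvcy.
    exact: measurable_sum_shifted_sqr.
  - move=> w /=; rewrite local_statistic_null thresholdE !mulr_natl => /ltW; exact.
rewrite sumEFin sumr_const card_ord lee_fin -mulr_natr -lE mulfK//.
by rewrite gt_eqF.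
Qed.

(** Accepting the null hypothesis forces the local statistic of the interval
    carrying the bump below the threshold, hence below its lower bound at
    probability [alpha]. *)
Lemma type2_error_lr_test_le (s := 1 + kappa sigma0 sigma ^+ 2) :
  threshold n alpha sigma0 Delta sigma len <=
    s * (m%:R * (1 + theta ^+ 2 * s) -
         2 * Num.sqrt (m%:R * (1 + 2 * (theta ^+ 2 * s)) * - ln alpha)) ->
  (type2_error Z sigma0 Delta sigma len (lr_test alpha sigma0 Delta sigma len)
     <= alpha%:E)%E.
Proof.
move=> ths.
have /andP[alpha0 alpha1] := alpha01.
have L0 : 0 < - ln alpha by rewrite oppr_gt0 ln_lt0// alpha0.
have s0 : 0 < s by rewrite ltr_wpDr// sqr_ge0.
rewrite /type2_error candidate_intervalsE.
apply: ge_ereal_sup => _ [_ [j jl <-] <-].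
have := noncentral_chisq_lower_tail iidZ (fun=> theta * Num.sqrt s)
  (block_neq0 jl) L0.
rewrite !sumr_const (card_block jl) opprK lnK//.
apply: le_trans; apply: le_measure; rewrite ?inE.
- rewrite (_ : [set w | ~~ _] = ~` [set w | lr_test alpha sigma0 Delta sigma len
    (HBR (bump_mean Delta (interval_at len j.+1))
      (bump_sd sigma0 sigma (interval_at len j.+1)) Z w)]);
    last by apply/seteqP; split => w /negP.
  apply: measurableC; rewrite lr_test_event; exact: bigcup_measurable.
- rewrite -[X in measurable X]setTI -preimage_itvNyc.
  exact: measurable_sum_shifted_sqr.
- move=> w /= /negP nPhi.
  rewrite leNgt; apply/negP => Sgt; apply: nPhi.
  apply/(lt_test_statisticP _ _ _ _ _ l_gt0); exists j => //.
  rewrite local_statistic_bump (le_lt_trans ths)// ltr_pM2l//.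
  move: Sgt; rewrite exprMn sqr_sqrtr ?(ltW s0)// !mulr_natl; exact.
Qed.

End errors.
End bump.

(** * Asymptotics *)

Lemma limn_esup_le_near (R : realType) (u : (\bar R)^nat) (a : \bar R) :
  (\forall k \near \oo, (u k <= a)%E) -> (limn_esup u <= a)%E.
Proof.
move=> ua; rewrite /limn_esup /limf_esup.
apply: (@le_trans _ _ (ereal_sup (u @` [set k | (u k <= a)%E]))).
  by apply: ereal_inf_lbound; exists [set k | (u k <= a)%E].
by apply: ge_ereal_sup => _ [k /= uka <-].
Qed.

(** Here [q ^+ 2] is the number of observations per interval,
    [k2 = kappa ^+ 2], [r ^+ 2 = - ln len], [y ^+ 2 = - ln alpha] and
    [e = eps / sigma0].  Bounding the square roots by [q * (1 + theta) * (r + y)]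
    and [3 * q * y], the claim reduces to
    [2 * q * (1 + theta) * (r + y) + 12 * q * y + 2 * (r ^+ 2 + y ^+ 2)
     <= q ^+ 2 * k2].  The right-hand side is at least [q * (2 + e) * r]; after
    removing [2 * q * r] and the terms in [theta] and [y], at least
    [q * e * r / 2] is left, and it dominates [r ^+ 2] because
    [16 * r <= q * e]. *)
Lemma threshold_le_bump_quantile (R : realType) (q k2 theta e r y : R)
    (s := 1 + k2) :
  0 <= q -> 0 <= r -> 0 <= y -> 0 <= theta <= 1 -> 0 <= k2 <= 1 ->
  (2 + e) * r <= q * k2 -> theta <= e / 8 -> k2 <= e / 8 ->
  64 * y <= e * r -> y <= r ->
  q ^+ 2 * (1 + theta ^+ 2) +
  2 * Num.sqrt (q ^+ 2 * (1 + 2 * theta ^+ 2) * (r ^+ 2 + y ^+ 2)) +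
  2 * (r ^+ 2 + y ^+ 2) <=
  s * (q ^+ 2 * (1 + theta ^+ 2 * s) -
       2 * Num.sqrt (q ^+ 2 * (1 + 2 * (theta ^+ 2 * s)) * y ^+ 2)).
Proof.
move=> q0 r0 y0 /andP[th0 th1] /andP[k0 k1] signal the ke ye yr.
have sqrt_le (z w : R) : 0 <= w -> z <= w ^+ 2 -> Num.sqrt z <= w.
  by move=> w0 zw; rewrite -[leRHS]ger0_norm// -sqrtr_sqr ler_wsqrtr.
have e0 : 0 <= e by lra.
have q20 : 0 <= q ^+ 2 by exact: sqr_ge0.
have qy0 : 0 <= q * y by rewrite mulr_ge0.
have th2 : 0 <= theta ^+ 2 <= 1.
  by rewrite sqr_ge0 expr_le1.
have null_term : Num.sqrt (q ^+ 2 * (1 + 2 * theta ^+ 2) * (r ^+ 2 + y ^+ 2)) <=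
    q * ((1 + theta) * (r + y)).
  apply: sqrt_le; first by rewrite !mulr_ge0 ?addr_ge0.
  rewrite !exprMn mulrA ler_pM//.
  - by rewrite mulr_ge0// addr_ge0// mulr_ge0//; case/andP: th2.
  - by rewrite addr_ge0 ?sqr_ge0.
  - by rewrite ler_wpM2l//; nra.
  - by nra.
have bump_term : Num.sqrt (q ^+ 2 * (1 + 2 * (theta ^+ 2 * s)) * y ^+ 2) <=
    q * (3 * y).
  apply: sqrt_le; first by rewrite !mulr_ge0.
  have -> : (q * (3 * y)) ^+ 2 = q ^+ 2 * 9 * y ^+ 2 by ring.
  rewrite ler_wpM2r ?sqr_ge0// ler_wpM2l// /s.
  case/andP: th2 => *; nra.
(* From [2 * r <= q * k2] and [k2 <= e / 8]. *)
have qe : 16 * r <= q * e by have := ler_wpM2l q0 ke; nra.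
(* Uses [1 <= s ^+ 2] for the noncentrality term. *)
have mean_gap : q ^+ 2 * (1 + theta ^+ 2) + q ^+ 2 * k2 <=
    s * (q ^+ 2 * (1 + theta ^+ 2 * s)).
  have : 0 <= q ^+ 2 * theta ^+ 2 * k2 by rewrite !mulr_ge0 ?sqr_ge0.
  have : 0 <= q ^+ 2 * theta ^+ 2 * k2 ^+ 2 by rewrite !mulr_ge0 ?sqr_ge0.
  rewrite /s; nra.
have bump_dev : s * (2 * (q * (3 * y))) <= 12 * (q * y) by rewrite /s; nra.
have cross : (1 + theta) * (r + y) <= r + e * r / 8 + 2 * y.
  by have := ler_wpM2r r0 the; have := ler_wpM2r y0 th1; nra.
have s0 : 0 <= s by rewrite /s; lra.
have gain : q * ((2 + e) * r) <= q ^+ 2 * k2.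
  by rewrite expr2 -mulrA ler_wpM2l.
have := ler_wpM2l q0 cross.
have := ler_wpM2l q0 ye.
have := ler_wpM2r r0 qe.
have : y ^+ 2 <= r ^+ 2 by rewrite ler_pXn2r.
have := ler_wpM2l s0 (ler_wpM2l (ler0n R 2) bump_term).
nra.
Qed.

Unset Implicit Arguments.

(* The asymptotics run along sample sizes n 0, n 1, ... tending to infinity:
   1/|I_n| and n|I_n| cannot be integers for every n under the remaining
   assumptions (consider prime n), so n ranges over admissible sample sizes. *)
Theorem theorem5p3 (R : realType)
    (d : nat -> measure_display) (T : forall k : nat, measurableType (d k))
    (P : forall k : nat, probability (T k) R)
    (n : nat -> nat)
    (Z : forall k : nat, 'I_(n k) -> {RV (P k) >-> R})
    (sigma0 alpha : R)
    (len Delta sigma theta eps : nat -> R) :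
  (forall k, iid_std_normal (Z k)) ->
  (forall k, (0 < n k)%N) ->
  n k @[k --> \oo] --> \oo ->
  0 < sigma0 ->
  0 < alpha < 1 ->
  (forall k, 0 < Delta k) ->
  (forall k, 0 < sigma k) ->
  (forall k, 0 < eps k) ->
  (forall k, 0 < len k <= 1) ->
  (forall k, (len k)^-1 \is a Num.nat) ->
  (forall k, (n k)%:R * len k \is a Num.nat) ->
  len k @[k --> \oo] --> 0 ->
  eps k * Num.sqrt (- ln (len k)) @[k --> \oo] --> +oo ->
  (forall k, sigma0 * Delta k = sigma k ^+ 2 * theta k) ->
  Delta k @[k --> \oo] --> 0 ->
  sigma k @[k --> \oo] --> 0 ->
  theta k @[k --> \oo] --> 0 ->
  (fun k => sigma k ^+ 2) =o_\oo eps ->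
  theta =o_\oo eps ->
  (\forall k \near \oo,
    (2 * sigma0 + eps k) * Num.sqrt (- ln (len k)) * theta k <=
      Num.sqrt ((n k)%:R * len k) * Delta k) ->
  let Phi k :=
    @lr_test R (n k) alpha sigma0 (Delta k) (sigma k) (len k) in
  (limn_esup (fun k => type1_error (Z k) sigma0 (Phi k)) <= alpha%:E)%E /\
  (limn_esup (fun k =>
     type2_error (Z k) sigma0 (Delta k) (sigma k) (len k) (Phi k))
   <= alpha%:E)%E.
Proof.
move=> iidZ n_gt0 _ sigma0_gt0 alpha01 Delta_gt0 sigma_gt0 eps_gt0 len01 lenV_nat
  nlen_nat len_cvg eps_ln thetaE _ sigma_cvg theta_cvg sigma2_o theta_o signal Phi.
have /andP[alpha_gt0 alpha_lt1] := alpha01.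
have natE k : {ml : nat * nat |
    (n k)%:R * len k = ml.1%:R /\ (len k)^-1 = ml.2%:R}.
  apply: cid; have /natrP[m mE] := nlen_nat k; have /natrP[l lE] := lenV_nat k.
  by exists (m, l).
split; apply: limn_esup_le_near.
  apply: nearW => k; have [[m l] /= [mE lE]] := natE k.
  have /andP[len_gt0 len_le1] := len01 k.
  exact: (type1_error_lr_test_le (n_gt0 k) len_gt0 mE lE (iidZ k) _ _ _ _ (thetaE k)).
have near_sigma2 : \forall k \near \oo, sigma k ^+ 2 <= sigma0 / 8 * eps k.
  have /eqoP/(_ (sigma0 / 8)) := sigma2_o.
  rewrite divr_gt0// => /(_ isT); apply: filterS => k.
  by rewrite ger0_norm ?sqr_ge0// ger0_norm// ltW.
have near_theta : \forall k \near \oo, theta k <= (8 * sigma0)^-1 * eps k.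
  have /eqoP/(_ (8 * sigma0)^-1) := theta_o.
  rewrite invr_gt0 mulr_gt0// => /(_ isT); apply: filterS => k.
  rewrite [`|eps k|](ger0_norm (ltW (eps_gt0 k))); by move=> /(le_trans (ler_norm _)).
pose y := Num.sqrt (- ln alpha).
near=> k.
have [[m l] /= [mE lE]] := natE k.
have /andP[len_gt0 len_le1] := len01 k.
apply: (type2_error_lr_test_le (n_gt0 k) len_gt0 mE lE (iidZ k)
  sigma0_gt0 alpha01 (sigma_gt0 k) (thetaE k)).
rewrite (thresholdE len_gt0 mE sigma0_gt0 alpha01 (sigma_gt0 k) (thetaE k)).
have theta_gt0 : 0 < theta k.
  by rewrite -(pmulr_rgt0 _ (exprn_gt0 2 (sigma_gt0 k))) -thetaE mulr_gt0.
set k2 := kappa sigma0 (sigma k) ^+ 2.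
have k2E : k2 = sigma k ^+ 2 / sigma0 ^+ 2 by rewrite /k2 /kappa expr_div_n.
have DeltaE : Delta k = sigma0 * k2 * theta k.
  have -> : Delta k = sigma k ^+ 2 * theta k / sigma0.
    by rewrite -thetaE mulrAC divff ?mul1r// gt_eqF.
  by rewrite k2E; field; rewrite gt_eqF.
pose q := Num.sqrt ((n k)%:R * len k).
pose r := Num.sqrt (- ln (len k)).
have qE : q ^+ 2 = m%:R by rewrite sqr_sqrtr mE.
have rE : r ^+ 2 = - ln (len k) by rewrite sqr_sqrtr// oppr_ge0 ln_le0.
have yE : y ^+ 2 = - ln alpha by rewrite sqr_sqrtr// oppr_ge0 ln_le0// ltW.
rewrite lnM ?posrE// opprD [- ln alpha + _]addrC -qE -rE -yE.
apply: (@threshold_le_bump_quantile R q k2 (theta k) (eps k / sigma0) r y).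
- exact: sqrtr_ge0.
- exact: sqrtr_ge0.
- exact: sqrtr_ge0.
- rewrite ltW//=; near: k; exact: (cvgr_le _ theta_cvg).
- have kappa_ge0 : 0 <= kappa sigma0 (sigma k).
    by rewrite divr_ge0// ltW.
  rewrite sqr_ge0 expr_le1//= ler_pdivrMr// mul1r.
  near: k; exact: (cvgr_le _ sigma_cvg).
- have : (2 * sigma0 + eps k) * r * theta k <= q * Delta k.
    rewrite /q /r; near: k; exact: signal.
  rewrite DeltaE (_ : _ * theta k = sigma0 * ((2 + eps k / sigma0) * r) * theta k).
    by rewrite [leRHS](_ : _ = sigma0 * (q * k2) * theta k);
      [rewrite ler_pM2r// ler_pM2l|ring].
  by field; rewrite gt_eqF.
- rewrite (_ : _ / 8 = (8 * sigma0)^-1 * eps k).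
    near: k; exact: near_theta.
  by field; rewrite gt_eqF.
- rewrite k2E ler_pdivrMr ?exprn_gt0// (_ : _ * sigma0 ^+ 2 = sigma0 / 8 * eps k).
    near: k; exact: near_sigma2.
  by field; rewrite gt_eqF.
- rewrite mulrAC ler_pdivlMr// /r; near: k.
  by have /cvgryPge := eps_ln; exact.
- rewrite /y /r ler_wsqrtr// lerN2 ler_ln ?posrE//.
  near: k; exact: (cvgr_le _ len_cvg).
Unshelve. all: by end_near. Qed.
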